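(* Let $X$ be a Tychonoff space. (i) If $X$ is Čech-complete and $C_p(X)$ is an Ascoli space, then $X$ is scattered. (ii) If $X$ is scattered and stratifiable, then $C_p(X)$ is an Ascoli space.
   Context: For a Tychonoff space $Y$, $C_p(Y)$ and $C_k(Y)$ denote the set $C(Y)$ of all continuous real-valued functions on $Y$ with the topology of pointwise convergence and the compact-open topology, respectively. A Tychonoff space $Y$ is called Ascoli if every compact subset $\mathcal K$ of $C_k(Y)$ is evenly continuous, i.e. the evaluation map $Y\times\mathcal K\to\mathbb R$, $(y,f)\mapsto f(y)$, is continuous. A space is scattered if each of its nonempty subspaces has an isolated point. A regular ($T_1$) space $X$ is stratifiable if there is a function $G$ assigning to every $n\in\omega$ and every closed set $F\subset X$ an open neighborhood $G(n,F)\subset X$ of $F$ such that $F=\bigcap_{n\in\omega}\overline{G(n,F)}$ and $G(n,F)\subset G(n,F')$ for all $n\in\omega$ and all closed sets $F\subset F'\subset X$. *)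

(* Defs.v *)
From HB Require Import structures.
From mathcomp Require Import all_boot all_order all_algebra.
From mathcomp Require Import all_classical all_reals all_analysis.
From mathcomp Require Import borel_hierarchy.

Set Implicit Arguments.
Unset Strict Implicit.
Unset Printing Implicit Defensive.

Import Order.TTheory GRing.Theory Num.Theory.
Import numFieldNormedType.Exports.

Local Open Scope classical_set_scope.
Local Open Scope ring_scope.

(* [completely_regular_space] is phrased in the library with uniformities; see
   [uniform_separatorP] for the form with a continuous function into [0, 1]. *)
Definition tychonoff_space (X : topologicalType) : Prop :=
  accessible_space X /\ completely_regular_space X.

Section FunctionSpaces.
Variables (R : realType) (Y : topologicalType).

Definition Cp : topologicalType :=
  initial_topology (fun f : continuousType Y R => (f : {ptws Y -> R})).

Definition Ck : topologicalType :=
  initial_topology (fun f : continuousType Y R => (f : {compact-open, Y -> R})).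

Definition evenly_continuous (K : set Ck) : Prop :=
  continuous (fun p : Y * set_type K => (val p.2 : continuousType Y R) p.1).

Definition ascoli_space : Prop :=
  tychonoff_space Y /\ forall K : set Ck, compact K -> evenly_continuous K.

End FunctionSpaces.

Definition scattered_space (X : topologicalType) : Prop :=
  forall A : set X, A !=set0 -> isolated A !=set0.

Definition topological_embedding (X Y : topologicalType) (e : X -> Y) : Prop :=
  [/\ injective e, continuous e &
      forall U : set X, open U -> open (e @` U : set (subspace (range e)))].

(* [X] is a G_delta subset of some Hausdorff compactification [K]; by a
   classical theorem this does not depend on the compactification, so that
   one may equally take the Stone-Cech compactification. *)
Definition cech_complete (X : topologicalType) : Prop :=
  tychonoff_space X /\
  exists (K : topologicalType) (e : X -> K),
    [/\ compact [set: K], hausdorff_space K, topological_embedding e,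
        dense (range e) & Gdelta (range e)].

Definition stratifiable_space (X : topologicalType) : Prop :=
  [/\ regular_space X, accessible_space X &
      exists G : nat -> set X -> set X,
        [/\ forall n F, closed F -> open (G n F) /\ F `<=` G n F,
            forall F, closed F -> F = \bigcap_n closure (G n F) &
            forall n F F', closed F -> closed F' -> F `<=` F' ->
              G n F `<=` G n F']].

(* Main.v *)
Require Import Defs.
From mathcomp Require Import all_boot all_order all_algebra.
From mathcomp Require Import all_classical all_reals all_analysis.
From mathcomp Require Import borel_hierarchy.

(* (i) If A is a nonempty subset of X without isolated points, a Cantor scheme
   in the compactification that meets A yields, via a minimal closed set L
   meeting all of its branches, pairwise disjoint finite sets F_n of points of
   X in L such that every nonempty relatively open subset of L meets all but
   finitely many F_n. Put U_n = {g | g > n on F_n}. Then 0 is in the closure of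
   every tail of (U_n), but a compact, hence pointwise bounded, subset of C_p(X)
   meets only finitely many U_n by a Baire category argument on L. Functions
   phi_n : C_p(X) -> [0, 1] that vanish off U_n thus converge to 0 in C_k, and
   {phi_n} U {0} is not evenly continuous at 0.
   (ii) In a scattered stratifiable space every disjoint sequence of finite sets
   has a point-finite open expansion. This makes C_p(X) kappa-Frechet-Urysohn: a
   point in the closure of an open set U is the limit of a sequence in U. Since
   a compact subset of C_k is equicontinuous along convergent sequences, it is
   then equicontinuous. *)

Set Implicit Arguments.
Unset Strict Implicit.
Unset Printing Implicit Defensive.

Import Order.TTheory GRing.Theory Num.Theory.
Import numFieldNormedType.Exports.

Local Open Scope classical_set_scope.
Local Open Scope ring_scope.

(** * The spaces C_p and C_k *)

(** The maximum of separators for the single points of [s], built by induction on [s]. *)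
Lemma uniform_separator_finite (R : realType) (X : topologicalType)
    (s : seq X) (U : set X) :
  completely_regular_space X -> open U -> (forall x, x \in s -> U x) ->
  exists u : X -> R, [/\ continuous u, forall x, 0 <= u x <= 1,
    forall x, x \in s -> u x = 1 & forall x, ~ U x -> u x = 0].
Proof.
move=> crX oU; elim: s => [|x s IH] sU.
  by exists (fun=> 0); split => // [|y]; [exact: cst_continuous|rewrite lexx ler01].
have [y ys|v [cv v01 v1 v0]] := IH; first by apply: sU; rewrite inE ys orbT.
have : uniform_separator [set x] (~` U).
  by apply: crX; [exact: open_closedC|apply; apply: sU; rewrite mem_head].
move=> /(@uniform_separatorP _ R)[w [cw w01 w0 w1]].
exists ((fun y => 1 - w y) \max v); split.
- apply: max_fun_continuous => // y.
  by apply: continuousB; [exact: cst_continuous|exact: cw].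
- move=> y /=; have /andP[vy0 vy1] := v01 y.
  have := w01 (w y) (ex_intro2 _ _ y I erefl); rewrite /= in_itv/= => /andP[wy0 wy1].
  by rewrite le_max vy0 orbT ge_max vy1 lerBlDr lerDl wy0.
- move=> y /=; rewrite inE => /orP[/eqP ->|/v1 ->].
    have -> : w x = 0 by apply: w0; exists x.
    by rewrite subr0; apply/max_idPl; have /andP[] := v01 x.
  have := w01 (w y) (ex_intro2 _ _ y I erefl); rewrite /= in_itv/= => /andP[wy0 wy1].
  by apply/max_idPr; rewrite lerBlDr lerDl.
- move=> y nUy /=; rewrite v0// (_ : w y = 1) ?subrr ?maxxx//.
  by apply: w1; exists y.
Qed.

Section PointwiseConvergence.
Variables (R : realType) (X : topologicalType).

Definition ev (f : Cp R X) (x : X) : R := (f : continuousType X R) x.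

Definition mkCp (f : X -> R) (cf : continuous f) : Cp R X :=
  (mkcts cf : continuousType X R).

Lemma ev_continuous_l (f : Cp R X) : continuous (ev f).
Proof. exact: (@cts_fun _ _ (f : continuousType X R)). Qed.

Lemma ev_continuous_r (x : X) : continuous (ev ^~ x).
Proof.
move=> f; have ci := @initial_continuous _ {ptws X -> R}
  (fun g : continuousType X R => (g : {ptws X -> R})).
by move=> A /(@proj_continuous X (fun=> R) x) /ci.
Qed.

Lemma Cp_cvg (F : set_system (Cp R X)) (f : Cp R X) : Filter F ->
  (forall x, ev g x @[g --> F] --> ev f x) -> F --> f.
Proof.
move=> FF Ff.
pose F' : set_system (X -> R) := ev @ F.
have FF' : Filter F' by exact: fmap_filter.
have Fp : {ptws, F' --> ev f}.
  by apply/(@pointwise_cvgP X R F' (ev f)) => x; exact: Ff.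
move=> A [_ [[B oB <-] Bf BA]].
have nB : nbhs (ev f : {ptws X -> R}) B by exact: open_nbhs_nbhs.
have FB : F (ev @^-1` B) := Fp _ nB.
by apply: filterS FB; exact: BA.
Qed.

(** The basic sets [B] generate a filter that converges to [f] pointwise, hence contains every
    neighbourhood of [f]. Conversely, each is a finite intersection of preimages of balls under
    evaluations. *)
Lemma Cp_nbhsP (f : Cp R X) (A : set (Cp R X)) :
  nbhs f A <-> exists (s : seq X) (e : R), 0 < e /\
    forall g : Cp R X, (forall x, x \in s -> `|ev g x - ev f x| < e) -> A g.
Proof.
pose B (p : seq X * R) :=
  [set g : Cp R X | forall x, x \in p.1 -> `|ev g x - ev f x| < p.2].
have FF : Filter (filter_from [set p : seq X * R | 0 < p.2] B).
  apply: filter_from_filter; first by exists ([::], 1) => /=.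
  move=> [s e] [t d] /= e0 d0; exists (s ++ t, Num.min e d) => /=.
    by rewrite lt_min e0.
  move=> g; rewrite /B/= => gst; split => x xs.
    by have := gst x; rewrite mem_cat xs => /(_ isT); rewrite lt_min => /andP[].
  by have := gst x; rewrite mem_cat xs orbT => /(_ isT); rewrite lt_min => /andP[].
split.
  have /(_ A) H : filter_from [set p : seq X * R | 0 < p.2] B --> f.
    apply: Cp_cvg => x; apply/cvgrPdist_lt => e e0.
    exists ([:: x], e) => //= g /(_ x); rewrite /= inE eqxx => /(_ isT).
    by rewrite distrC.
  by move=> /H [[s e] /= e0 BA]; exists s, e.
case=> s [e [e0 sA]]; apply: filterS sA _.
elim: s => [|x s IH]; first by apply: filterE => g y.
have fx : \forall g \near f, `|ev g x - ev f x| < e.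
  have /cvgrPdist_lt/(_ _ e0) := @ev_continuous_r x f.
  by apply: filterS => g; rewrite distrC.
apply: filterS2 fx IH => g gx gs y.
by rewrite inE => /orP[/eqP ->//|/gs].
Qed.

Lemma Cp_tychonoff : tychonoff_space (Cp R X).
Proof.
split.
  move=> f g fg; have [x fgx] : exists x, ev f x <> ev g x.
    apply/existsNP => fgE; move/eqP: fg; apply.
    by apply/(@continuousEP X R f g) => x; exact: fgE.
  exists [set h | ev h x != ev g x]; split.
  - have -> : [set h | ev h x != ev g x] = (ev ^~ x) @^-1` (~` [set ev g x]).
      by apply/seteqP; split => h /= /eqP.
    apply: open_comp; first by move=> ? _; exact: ev_continuous_r.
    by rewrite openC; exact: accessible_closed_set1
      (hausdorff_accessible (@Rhausdorff R)) _.
  - by rewrite inE/=; exact/eqP.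
  - by rewrite inE/= eqxx.
(* Complete regularity comes from the uniformity induced by that of pointwise convergence. *)
exact: (@uniform_completely_regular R
  (@initial_topology (continuousType X R) {ptws X -> R} id)).
Qed.

End PointwiseConvergence.

(** * Compact subsets of C_k and the Ascoli property *)

Section CompactOpen.
Variables (R : realType) (Y : topologicalType).

Definition evk (f : Ck R Y) (y : Y) : R := (f : continuousType Y R) y.

Lemma evk_continuous (f : Ck R Y) : continuous (evk f).
Proof. exact: (@cts_fun _ _ (f : continuousType Y R)). Qed.

Lemma Ck_nbhs (f : Ck R Y) (S : set Y) (W : set R) : compact S -> open W ->
  (forall y, S y -> W (evk f y)) ->
  nbhs f [set g : Ck R Y | forall y, S y -> W (evk g y)].
Proof.
move=> cS oW fSW; have ci := @initial_continuous _ {compact-open, Y -> R}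
  (fun g : continuousType Y R => (g : {compact-open, Y -> R})).
have nW : nbhs (evk f : {compact-open, Y -> R})
    [set g : {compact-open, Y -> R} | g @` S `<=` W].
  apply: open_nbhs_nbhs; split; first exact: compact_open_open.
  by move=> _ [y /fSW Wy <-].
have nf : nbhs f (evk @^-1` [set g : {compact-open, Y -> R} | g @` S `<=` W]) :=
  ci f _ nW.
by apply: filterS nf => g gSW y Sy; apply: gSW; exists y.
Qed.

Lemma Ck_cvg (F : set_system (Ck R Y)) (f : Ck R Y) : Filter F ->
  (forall S W, compact S -> open W -> (forall y, S y -> W (evk f y)) ->
    F [set g : Ck R Y | forall y, S y -> W (evk g y)]) -> F --> f.
Proof.
move=> FF Ff; pose F' : set_system {compact-open, Y -> R} := evk @ F.
have FF' : Filter F' by exact: fmap_filter.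
have Fp : F' --> (evk f : {compact-open, Y -> R}).
  apply/compact_open_cvgP => S W cS oW fSW.
  have fy y : S y -> W (evk f y) by move=> Sy; apply: fSW; exists y.
  have FSW := Ff S W cS oW fy.
  suff : F (evk @^-1` [set g : {compact-open, Y -> R} | g @` S `<=` W]) by [].
  by apply: filterS FSW => g gSW _ [y Sy <-]; exact: gSW.
move=> A [_ [[B oB <-] Bf BA]].
have nB : nbhs (evk f : {compact-open, Y -> R}) B by exact: open_nbhs_nbhs.
have FB : F (evk @^-1` B) := Fp _ nB.
by apply: filterS FB; exact: BA.
Qed.

(** If [z] is not a cluster point of a filter on this set, some member of the filter misses a
    neighbourhood of [z], so the filter lives on finitely many terms. *)
Lemma compact_cvg_seq (y : nat -> Y) (z : Y) (N : nat) : y @ \oo --> z ->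
  compact ([set z] `|` y @` [set n | (N <= n)%N]).
Proof.
move=> yz F FF FS; set S := (X in F X) in FS.
have [clz|] := pselect (cluster F z); first by exists z; split => //; left.
move=> /existsNP[B] /existsNP[V] /not_implyP[FB] /not_implyP[zV BV].
have [M _ yV] := yz _ zV.
have : compact (S `&` y @` `I_M).
  apply: finite_compact; apply: sub_finite_set (_ : finite_set (y @` `I_M)).
    by move=> x [].
  exact: finite_image.
move=> /(_ F FF); case.
  apply: filterS (filterI FS FB) => x [Sx Bx].
  have nVx : ~ V x by move=> Vx; apply: BV; exists x.
  split => //; case: Sx => [xz|[n _ ynx]].
    by case: nVx; rewrite xz; exact: nbhs_singleton.
  exists n => //=; rewrite ltnNge; apply/negP => Mn; apply: nVx.
  by rewrite -ynx; exact: yV.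
by move=> x [[Sx _] clx]; exists x.
Qed.

(** Otherwise [z] is the limit of points [y n] at which some [g n] in [K] is off by more than [e]. A
    cluster point [h] of [g] varies by less than [e / 2] on [z] and a tail of [y]. This set is
    compact, so some [g n] has there all its values within [e / 2] of [h z], a contradiction. *)
Lemma kappa_Frechet_Urysohn_equicontinuous :
  (forall (U : set Y) z, open U -> closure U z ->
    exists2 y : nat -> Y, (forall n, U (y n)) & y @ \oo --> z) ->
  forall K : set (Ck R Y), compact K -> forall (z : Y) (e : R), 0 < e ->
  \forall y \near z, forall g, K g -> `|evk g y - evk g z| <= e.
Proof.
move=> kFU K cK z e e0.
pose U := \bigcup_(g in K) [set y | e < `|evk g y - evk g z|].
have oU : open U.
  apply: bigcup_open => g _.
  apply: (@open_comp _ _ (fun y => `|evk g y - evk g z|) [set r | e < r]) => [y _|].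
    apply: (cvg_norm (V := R)); apply: cvgB; last exact: cvg_cst.
    exact: evk_continuous.
  exact: open_gt.
have [/(kFU _ _ oU)[y Uy yz]|] := pselect (closure U z); last first.
  move=> /existsNP[V] /not_implyP[zV UV]; apply: filterS zV => x Vx g Kg.
  rewrite leNgt; apply/negP => egx; apply: UV; exists x; split => //.
  by exists g.
have /choice[g gK] : forall n, exists g : Ck R Y,
    K g /\ e < `|evk g (y n) - evk g z|.
  by move=> n; have [g Kg eg] := Uy n; exists g.
have gF : ProperFilter (g @ \oo) by exact: fmap_proper_filter.
have [|h [Kh clh]] := cK _ gF.
  by exists 0%N => // n _; have [] := gK n.
have e20 : 0 < e / 2 by rewrite divr_gt0.
have [N _ hy] : \forall n \near \oo, `|evk h z - evk h (y n)| < e / 2.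
  have /cvgrPdist_lt/(_ _ e20) : evk h (y n) @[n --> \oo] --> evk h z.
    by apply: cvg_comp yz _; exact: evk_continuous.
  exact.
pose W := [set r : R | `|evk h z - r| < e / 2].
have /clh : (g @ \oo) (g @` [set n | (N <= n)%N]).
  by exists N => // n Nn; exists n.
have oW : open W.
  by have -> : W = ball (evk h z) (e / 2) by []; exact: ball_open.
have hW : nbhs h [set f : Ck R Y |
    forall x, ([set z] `|` y @` [set n | (N <= n)%N]) x -> W (evk f x)].
  apply: Ck_nbhs => //; first exact: compact_cvg_seq.
  by move=> x [->|[n Nn <-]]; [rewrite /W/= subrr normr0|exact: hy].
move=> /(_ _ hW)[_ [[n Nn <-] gW]].
have [_] := gK n; rewrite ltNge => /negP; case.
have /ltW z1 : W (evk (g n) z) by apply: gW; left.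
have /ltW z2 : W (evk (g n) (y n)) by apply: gW; right; exists n.
rewrite (splitr e) -(subrKA (evk h z)) (le_trans (ler_normD _ _))// addrC.
by rewrite lerD// distrC.
Qed.

Lemma kappa_Frechet_Urysohn_ascoli : tychonoff_space Y ->
  (forall (U : set Y) z, open U -> closure U z ->
    exists2 y : nat -> Y, (forall n, U (y n)) & y @ \oo --> z) ->
  ascoli_space R Y.
Proof.
move=> tY kFU; split => // K cK [z f].
apply/cvgrPdist_lt => e e0.
have e20 : 0 < e / 2 by rewrite divr_gt0.
have zK := kappa_Frechet_Urysohn_equicontinuous kFU cK z e20.
have fz : \forall g \near f, `|evk (val f) z - evk (val g) z| < e / 2.
  have nz : nbhs (val f) [set g : Ck R Y | forall y, [set z] y ->
      ball (evk (val f) z) (e / 2) (evk g y)].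
    apply: Ck_nbhs; [exact: compact_set1|exact: ball_open|].
    by move=> _ ->; exact: ballxx.
  have nf := @initial_continuous _ _ (set_val : K -> Ck R Y) f _ nz.
  exact: (@filterS _ _ (nbhs_filter f) _ _ (fun g gz => gz z erefl) nf).
exists ([set y | forall g, K g -> `|evk g y - evk g z| <= e / 2],
  [set g : K | `|evk (val f) z - evk (val g) z| < e / 2]) => //.
(* Half of [e] pays for passing from [f] to [g] at [z], the other half for passing from [z] to [y],
   uniformly over [K]. *)
move=> [y g] /= [zy fg].
rewrite (splitr e) -(subrKA (evk (val g) z)) (le_lt_trans (ler_normD _ _))//.
by rewrite ltr_leD// distrC; apply: zy; exact: set_valP.
Qed.

End CompactOpen.

(** * Scattered stratifiable spaces *)

Section CantorBendixson.
Variable X : topologicalType.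

Definition cb_step (D : set X) : set X := D `|` isolated (~` D).

(** The complements of the Cantor-Bendixson derivatives, generated without ordinals; the empty union
    supplies the starting set [set0]. *)
Inductive cb_tower : set X -> Prop :=
| cb_tower_step D : cb_tower D -> cb_tower (cb_step D)
| cb_tower_bigcup (F : set (set X)) :
    (forall D, F D -> cb_tower D) -> cb_tower (\bigcup_(D in F) D).

(** These are the extreme points of the Bourbaki-Witt argument: all members of the tower turn out to
    be extreme, which makes the tower a chain. *)
Let extreme (C : set X) :=
  forall D, cb_tower D -> D `<=` C -> ~ C `<=` D -> cb_step D `<=` C.

Let extreme_dichotomy C : extreme C -> forall D, cb_tower D ->
  D `<=` C \/ cb_step C `<=` D.
Proof.
move=> eC D; elim=> {D} [D tD [DC|CD]|F tF IH].
- have [CD|nCD] := pselect (C `<=` D); last by left; exact: eC.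
  by right; have -> : C = D by apply/seteqP.
- by right => x /CD Dx; left.
- have [FC|/existsNP[D /not_implyP[FD nDC]]] :=
    pselect (forall D, F D -> D `<=` C).
    by left => x [D FD Dx]; exact: FC Dx.
  by have [//|CD] := IH _ FD; right => x /CD Dx; exists D.
Qed.

Let tower_extreme C : cb_tower C -> extreme C.
Proof.
elim=> {C} [C tC eC|F tF IH] D tD DC nCD.
  have [DC'|//] := extreme_dichotomy eC tD.
  have [CD|nC'D] := pselect (C `<=` D).
    by have -> : C = D by apply/seteqP.
  by move=> x /(eC _ tD DC' nC'D) Cx; left.
(* If [D] contained [cb_step C] for every [C] in [F], it would contain the union. *)
have [C FC nCD'] : exists2 C, F C & ~ cb_step C `<=` D.
  apply: contrapT => nF; apply: nCD => x [C FC Cx].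
  apply: contrapT => nDx; apply: nF; exists C => // CD.
  by apply: nDx; apply: CD; left.
have [DC'|//] := extreme_dichotomy (IH _ FC) tD.
have [CD|nC'D] := pselect (C `<=` D); last first.
  by move=> x /(IH _ FC _ tD DC' nC'D) Cx; exists C.
have eD : extreme D by rewrite (_ : D = C); [exact: IH|exact/seteqP].
by have [FD|//] := extreme_dichotomy eD (cb_tower_bigcup tF).
Qed.

Lemma cb_tower_total C D : cb_tower C -> cb_tower D -> C `<=` D \/ D `<=` C.
Proof.
move=> tC tD; have [|CD] := extreme_dichotomy (tower_extreme tC) tD.
  by right.
by left => x Cx; apply: CD; left.
Qed.

Lemma cb_tower_open D : cb_tower D -> open D.
Proof.
elim=> {D} [D _ oD|F _ oF]; last by apply: bigcup_open => D /oF.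
rewrite openE => x [Dx|[_ [V Vx VD]]].
  apply: filterS (_ : nbhs x D); first by move=> y; left.
  exact: open_nbhs_nbhs.
move: (Vx); apply: filterS => y Vy.
have [Dy|nDy] := pselect (D y); first by left.
have yx : y = x by suff : [set x] y; [|rewrite -VD].
by right; split; [exact: mem_set|rewrite yx; exists V].
Qed.

(* [O x] consists of [x] and of points of smaller Cantor-Bendixson rank. *)
Lemma scattered_neighbornet : scattered_space X ->
  exists O : X -> set X, [/\ forall x, open (O x), forall x, O x x &
    forall x y, O x y -> O y x -> x = y].
Proof.
move=> scX.
(* [D x] is the largest tower member that omits [x], so [x] must enter at the very next step: a step
   that omits [x] would add nothing, against scatteredness. *)
pose D x := \bigcup_(T in [set T | cb_tower T /\ ~ T x]) T.
have tD x : cb_tower (D x) by apply: cb_tower_bigcup => T [].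
have nDx x : ~ D x x by case=> T [].
have stepx x : cb_step (D x) x.
  apply: contrapT => nx.
  have [y iy] : isolated (~` D x) !=set0 by apply: scX; exists x; exact: nDx.
  have /(_ y) : cb_step (D x) `<=` D x.
    by move=> z sz; exists (cb_step (D x)) => //; split => //; exact: cb_tower_step.
  by move/(_ (or_intror iy)); exact: isolatedS iy.
exists (fun x => D x `|` [set x]); split.
- move=> x; rewrite openE => y [Dy|->].
    apply: filterS (_ : nbhs y (D x)); first by move=> z; left.
    by apply: open_nbhs_nbhs; split => //; exact: cb_tower_open.
  have [/nDx//|[_ [V Vx VD]]] := stepx x.
  apply: filterS Vx => z Vz; have [Dz|nDz] := pselect (D x z); first by left.
  by right; rewrite -VD; split.
- by move=> x; right.
- move=> x y [[T [tT nTx] Ty]|->//] [[S [tS nSy] Sx]|->//].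
  by have [TS|ST] := cb_tower_total tT tS; [have := TS _ Ty|have := ST _ Sx].
Qed.

End CantorBendixson.

(* If [y] is in [U n] because of [x] in [F n], then stratifiability puts [x] in
   the neighbornet set of [y] for large [n], while [y] is in that of [x]. *)
Lemma scattered_stratifiable_point_finite (X : topologicalType) (F : nat -> set X) :
  scattered_space X -> stratifiable_space X -> trivIset [set: nat] F ->
  exists U : nat -> set X, [/\ forall n, open (U n), forall n, F n `<=` U n &
    forall y, \forall n \near \oo, ~ U n y].
Proof.
move=> /scattered_neighbornet[N [oN Nx Ninj]] [_ aX [G [GF GI Gmono]]] tF.
have cl1 (x : X) : closed [set x] by exact: accessible_closed_set1.
(* Intersecting over all [i <= n] lets one index [m] serve every [n >= m]. *)
pose V n x := \big[setI/setT]_(i < n.+1) G i [set x] `&` N x.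
have GV n x y i : (i <= n)%N -> V n x y -> G i [set x] y.
  by move=> im [+ _]; rewrite -(bigcap_mkord n.+1 (fun i => G i [set x])); exact.
exists (fun n => \bigcup_(x in F n) V n x); split.
- move=> n; apply: bigcup_open => x _; apply: openI => //.
  apply: big_ind; [exact: openT|exact: openI|].
  by move=> i _; have [] := GF i _ (cl1 x).
- move=> n x Fx; exists x => //; split => //.
  rewrite -(bigcap_mkord n.+1 (fun i => G i [set x])) => i _.
  by have [_] := GF i _ (cl1 x); exact.
- move=> y.
  have cNy : closed (~` N y) by exact: open_closedC.
  have [m nGy] : exists m, ~ closure (G m (~` N y)) y.
    apply/existsNP => Gy; have : (~` N y) y by rewrite (GI _ cNy) => n _; exact: Gy.
    exact.
  (* From [m] on, [y] is covered only if it lies in [F n] itself, which by disjointness happens for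
     at most one [n]. *)
  have UF n : (m <= n)%N -> (\bigcup_(x in F n) V n x) y -> F n y.
    move=> mn [x Fx Vy]; rewrite (Ninj y x)//; last by case: Vy.
    apply: contrapT => nNx; apply/nGy/subset_closure.
    by apply: (Gmono m [set x]) (GV _ _ _ _ mn Vy) => // z ->.
  have [[k Fk]|nF] := pselect (exists k, F k y).
    exists (maxn m k.+1) => // n /=; rewrite geq_max => /andP[mn kn] /(UF _ mn) Fn.
    have kE := tF k n I I (ex_intro _ y (conj Fk Fn)).
    by rewrite kE ltnn in kn.
  by exists m => // n /= mn /(UF _ mn) Fn; apply: nF; exists n.
Qed.

(** * From point-finite expansions to convergent sequences in C_p *)

Definition clip (R : realType) (e r : R) : R := Num.max (- e) (Num.min e r).

Lemma clip_id (R : realType) (e r : R) : `|r| < e -> clip e r = r.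
Proof.
move=> /ltW; rewrite /clip ler_norml => /andP[er re].
by rewrite (min_idPr re); apply/max_idPr.
Qed.

Lemma norm_clip_le (R : realType) (e r : R) : 0 < e -> `|clip e r| <= e.
Proof.
move=> e0; rewrite ler_norml /clip le_max lexx /= ge_max ge_min lexx /= andbT.
by rewrite (@le_trans _ _ 0) ?oppr_le0 ?ltW.
Qed.

Lemma continuous_clip (R : realType) (X : topologicalType) (e : R) (f : X -> R) :
  continuous f -> continuous (fun x => clip e (f x)).
Proof.
move=> cf; apply: (@max_fun_continuous _ _ R (fun=> - e) (fun x => Num.min e (f x))).
  exact: cst_continuous.
by apply: (@min_fun_continuous _ _ R (fun=> e) f) => //; exact: cst_continuous.
Qed.

Section KappaFrechetUrysohn.
Variables (R : realType) (X : topologicalType).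
Hypothesis crX : completely_regular_space X.

(* [y_n = z + u_n (f_n - z) + (1 - u_n) clip (f_n - z)] agrees with [f_n] where
   [u_n = 1] or [f_n] is close to [z], and is close to [z] where [u_n = 0]. *)
Lemma Cp_kappa_Frechet_Urysohn :
  (forall F : nat -> set X, trivIset [set: nat] F ->
    exists U : nat -> set X, [/\ forall n, open (U n), forall n, F n `<=` U n &
      forall y, \forall n \near \oo, ~ U n y]) ->
  forall (U : set (Cp R X)) z, open U -> closure U z ->
    exists2 y : nat -> Cp R X, (forall n, U (y n)) & y @ \oo --> z.
Proof.
move=> pf U z oU clUz.
(* One step picks a function of [U] close to [z] on the given finite set, with a finite set on which
   agreement with it guarantees membership in [U]. *)
have /choice[step stepP] : forall p : nat * seq X, exists q : Cp R X * seq X,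
    (forall x, x \in p.2 -> `|ev q.1 x - ev z x| < p.1.+1%:R^-1) /\
    (forall g : Cp R X, (forall x, x \in q.2 -> ev g x = ev q.1 x) -> U g).
  move=> [n E] /=.
  have [f [Uf fE]] : U `&` [set f | forall x, x \in E ->
      `|ev f x - ev z x| < n.+1%:R^-1] !=set0.
    apply: clUz; apply/Cp_nbhsP; exists E, n.+1%:R^-1.
    by rewrite invr_gt0 ltr0n.
  have /Cp_nbhsP[s [e [e0 sU]]] : nbhs f U by exact: open_nbhs_nbhs.
  exists (f, s); split => //= g gf; apply: sU => x xs.
  by rewrite gf// subrr normr0.
pose E := fix E n := if n is m.+1 then E m ++ (step (m, E m)).2 else [::] : seq X.
pose f n := (step (n, E n)).1.
pose s n := (step (n, E n)).2.
have Emono m n : (m <= n)%N -> {subset E m <= E n}.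
  elim: n => [|n IH]; first by rewrite leqn0 => /eqP ->.
  rewrite leq_eqVlt => /orP[/eqP -> //|]; rewrite ltnS => /IH mn x /mn xn.
  by rewrite /= mem_cat xn.
(* [E n] collects the earlier sets [s], so keeping only the new points of [s n] gives disjoint sets
   [F n]. *)
have sE n : {subset s n <= E n.+1} by move=> x xs; rewrite /= mem_cat xs orbT.
pose F n := [seq x <- s n | x \notin E n].
have [|V [oV FV Vpf]] := pf (fun n => [set` F n]).
  apply: ltn_trivIset => i j ij; apply/seteqP; split => // x [/=].
  rewrite !mem_filter => /andP[_ /sE/(Emono _ _ ij) xj] /andP[].
  by rewrite xj.
have /choice[u uP] n : exists u : X -> R, [/\ continuous u, forall x, 0 <= u x <= 1,
    forall x, x \in F n -> u x = 1 & forall x, ~ V n x -> u x = 0].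
  by apply: uniform_separator_finite => // x; exact: FV.
pose d n x := ev (f n) x - ev z x.
pose c n x := clip n.+1%:R^-1 (d n x).
pose h n x := ev z x + (u n x * d n x + (1 - u n x) * c n x).
have cd n : continuous (d n).
  by move=> x; apply: cvgB; exact: ev_continuous_l.
have ch n : continuous (h n).
  have [cu _ _ _] := uP n.
  move=> x; apply: cvgD; first exact: ev_continuous_l.
  apply: cvgD; apply: cvgM; [exact: cu|exact: cd| |exact: continuous_clip].
  by apply: cvgB; [exact: cvg_cst|exact: cu].
exists (fun n => mkCp (ch n)).
  move=> n; apply: (stepP (n, E n)).2 => x /= xs.
  have [_ _ u1 _] := uP n.
  suff : h n x = ev (f n) x by [].
  rewrite /h.
  have [xE|xE] := boolP (x \in E n).
    rewrite /c clip_id; last exact: (stepP (n, E n)).1.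
    by rewrite -mulrDl subrKC mul1r /d subrKC.
  rewrite u1 ?mem_filter ?xE// subrr mul0r addr0 mul1r.
  by rewrite /d subrKC.
apply: Cp_cvg => x; apply/cvgrPdist_le => e e0.
suff : \forall n \near \oo, `|ev z x - h n x| <= e by [].
near=> n; rewrite /h.
have [_ _ _ ->] := uP n; last by near: n; exact: Vpf.
rewrite mul0r add0r subr0 mul1r distrC addrAC subrr add0r.
rewrite (le_trans (norm_clip_le _ _)) ?invr_gt0//.
by apply: ltW; near: n; exact: near_infty_natSinv_lt (PosNum e0).
Unshelve. all: by end_near. Qed.

End KappaFrechetUrysohn.

Lemma Cp_scattered_stratifiable_ascoli (R : realType) (X : topologicalType) :
  tychonoff_space X -> scattered_space X -> stratifiable_space X ->
  ascoli_space R (Cp R X).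
Proof.
move=> [_ crX] scX stX.
apply: kappa_Frechet_Urysohn_ascoli; first exact: Cp_tychonoff.
apply: Cp_kappa_Frechet_Urysohn => // F.
exact: scattered_stratifiable_point_finite.
Qed.

(** * Cech-complete spaces *)

(** A cluster point of the filter generated by the family lies in all of its closed members. *)
Lemma directed_bigcap_nonempty (T : topologicalType) (I : Type) (D : set I)
    (f : I -> set T) :
  compact [set: T] -> D !=set0 -> (forall i, D i -> closed (f i)) ->
  (forall i, D i -> f i !=set0) ->
  (forall i j, D i -> D j -> exists2 k, D k & f k `<=` f i `&` f j) ->
  \bigcap_(i in D) f i !=set0.
Proof.
move=> cT D0 cf f0 fI.
have FF : ProperFilter (filter_from D f).
  by apply: filter_from_proper => //; exact: filter_from_filter.
have [p [_ clp]] := cT _ FF filterT.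
exists p => i Di; apply: cf => // B pB.
by apply: clp => //; exists i.
Qed.

(** * Cantor schemes in a compact Hausdorff space *)

Section CantorScheme.
Variable K : topologicalType.
Hypotheses (cK : compact [set: K]) (hK : hausdorff_space K).

(* Words grow on the left: [b :: s] is a child of [s]. *)
Definition cantor_scheme (V : seq bool -> set K) : Prop :=
  [/\ forall s, open (V s), forall s, V s !=set0,
    forall b s, closure (V (b :: s)) `<=` V s &
    forall s, closure (V (true :: s)) `&` closure (V (false :: s)) = set0].

Lemma compact_hausdorff_shrink (x : K) (U : set K) : nbhs x U ->
  exists V : set K, [/\ open V, V x & closure V `<=` U].
Proof.
move=> Ux; have [N Nx NU] := compact_regular hK cK filterT Ux.
exists (interior N); split; [exact: open_interior|exact: nbhs_singleton (nbhs_interior Nx)|].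
exact: subset_trans (closureS (@interior_subset _ N)) NU.
Qed.

Lemma crowded_cantor_scheme (B : set K) (W : nat -> set K) : B !=set0 ->
  (forall (x : K) U, B x -> nbhs x U -> exists y, [/\ B y, U y & y != x]) ->
  (forall n, open (W n) /\ B `<=` W n) ->
  exists2 V, cantor_scheme V & forall b s, V (b :: s) `<=` W (size s).
Proof.
move=> [x0 Bx0] crowded WP.
(* Each set of the scheme keeps meeting [B], so crowdedness supplies two points of [B] to separate
   inside it. *)
pose good V := open V /\ V `&` B !=set0.
have /choice[sp spP] : forall p : set K * nat, exists q : bool -> set K,
    good p.1 -> [/\ forall b, good (q b), forall b, closure (q b) `<=` p.1 `&` W p.2 &
      closure (q true) `&` closure (q false) = set0].
  move=> [V n] /=; have [[oV [x [Vx Bx]]]|nV] := pselect (good V); last first.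
    by exists (fun=> set0).
  have [oW BW] := WP n.
  have nVW y : V y -> B y -> nbhs y (V `&` W n).
    by move=> Vy By; apply: open_nbhs_nbhs; split; [exact: openI|split; [|exact: BW]].
  have [y [By [Vy _] yx]] := crowded x _ Bx (nVW x Vx Bx).
  move: hK; rewrite open_hausdorff => /(_ _ _ yx)[[P Q] /= [Py Qx] [oP oQ PQ]].
  rewrite !inE in Py Qx.
  have [V1 [oV1 V1y V1P]] := compact_hausdorff_shrink
    (filterI (nVW y Vy By) (open_nbhs_nbhs (conj oP Py))).
  have [V0 [oV0 V0x V0Q]] := compact_hausdorff_shrink
    (filterI (nVW x Vx Bx) (open_nbhs_nbhs (conj oQ Qx))).
  exists (fun b => if b then V1 else V0) => _; split.
  - by case; split => //; [exists y|exists x].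
  - by case=> z; [move/V1P|move/V0Q] => -[].
  - apply/seteqP; split => // z [/V1P[_ Pz] /V0Q[_ Qz]].
    by rewrite -(eqP PQ).
pose V := fix V s := if s is b :: s' then sp (V s', size s') b else [set: K].
have gV s : good (V s).
  elim: s => [|b s IH] /=; last by have [+ _ _] := spP (V s, size s) IH; exact.
  by split; [exact: openT|exists x0].
exists V.
  split.
  - by move=> s; have [] := gV s.
  - by move=> s; have [_ [x [Vx _]]] := gV s; exists x.
  - by move=> b s x; have [_ + _] := spP (V s, size s) (gV s) => /(_ b x)/[apply] -[].
  - by move=> s; have [_ _] := spP (V s, size s) (gV s).
move=> b s x /subset_closure.
by have [_ + _] := spP (V s, size s) (gV s) => /(_ b x)/[apply] -[].
Qed.

Variable V : seq bool -> set K.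
Hypothesis VP : cantor_scheme V.

(** Initial segments are reversed because words grow on the left. *)
Definition branch (sigma : nat -> bool) : set K :=
  \bigcap_n closure (V (rev (mkseq sigma n))).

Lemma rev_mkseqS (sigma : nat -> bool) n :
  rev (mkseq sigma n.+1) = sigma n :: rev (mkseq sigma n).
Proof. by rewrite mkseqS rev_rcons. Qed.

Lemma scheme_cat s t : V (t ++ s) `<=` V s.
Proof.
have [_ _ VS _] := VP.
by elim: t => [|b t IH] //= x /subset_closure/VS/IH.
Qed.

Lemma branch_scheme sigma n : branch sigma `<=` V (rev (mkseq sigma n)).
Proof.
have [_ _ VS _] := VP.
by move=> x /(_ n.+1 I); rewrite rev_mkseqS => /VS.
Qed.

Lemma branch_inj sigma tau x : branch sigma x -> branch tau x -> sigma =1 tau.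
Proof.
move=> sx tx; have [_ _ _ V01] := VP.
suff st n : rev (mkseq sigma n) = rev (mkseq tau n).
  by move=> n; have := st n.+1; rewrite !rev_mkseqS => -[].
elim: n => // n IH; rewrite !rev_mkseqS IH; congr cons.
have := sx n.+1 I; have := tx n.+1 I; rewrite !rev_mkseqS IH.
have nV : ~ (closure (V (true :: rev (mkseq tau n))) x /\
    closure (V (false :: rev (mkseq tau n))) x).
  by move=> xV; rewrite -[False]/(set0 x) -(V01 (rev (mkseq tau n))).
by case: (sigma n); case: (tau n) => // *; case: nV.
Qed.

Lemma closed_meets_branch (L : set K) sigma : closed L ->
  (forall n, L `&` closure (V (rev (mkseq sigma n))) !=set0) ->
  L `&` branch sigma !=set0.
Proof.
move=> cL Lsigma.
have [_ _ VS _] := VP.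
have dV m n : (m <= n)%N ->
    closure (V (rev (mkseq sigma n))) `<=` closure (V (rev (mkseq sigma m))).
  elim: n => [|n IH]; first by rewrite leqn0 => /eqP ->.
  rewrite leq_eqVlt => /orP[/eqP ->//|]; rewrite ltnS => /IH; apply: subset_trans.
  by rewrite rev_mkseqS => x /VS; exact: subset_closure.
have [|n _|//|m n _ _|x Lx] := @directed_bigcap_nonempty K nat setT
    (fun n => L `&` closure (V (rev (mkseq sigma n)))) cK.
- by exists 0%N.
- by apply: closedI => //; exact: closed_closure.
- by exists (maxn m n) => // x [Lx xV]; split; split => //;
    apply: dV xV; rewrite ?leq_maxl ?leq_maxr.
- by exists x; split => [|n _]; [have [] := Lx 0%N I|have [] := Lx n I].
Qed.

(* A minimal closed set meeting every branch plays the part of the domain of an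
   irreducible map onto the Cantor space. *)
Lemma irreducible_transversal : exists L : set K,
  [/\ closed L, forall sigma, L `&` branch sigma !=set0 &
    forall U, open U -> L `&` U !=set0 -> exists sigma N,
      forall n, (N <= n)%N -> L `&` closure (V (rev (mkseq sigma n))) `<=` U].
Proof.
have [oV V0 VS _] := VP.
(* Zorn's lemma is applied to the open complements, a maximal one giving a minimal closed set. The
   empty chain needs every branch to be nonempty. *)
pose P B := open B /\ forall sigma, ~` B `&` branch sigma !=set0.
have [F FP totF|B [[oB Bsigma] maxB]] := @Zorn_bigcup K P.
  have [[B0 FB0]|nF] := pselect (F !=set0); last first.
    have -> : \bigcup_(X in F) X = set0.
      by apply/seteqP; split => // x [B FB]; case: nF; exists B.
    split; first exact: open0.
    move=> sigma; rewrite setC0; apply: closed_meets_branch; first exact: closedT.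
    by move=> n; have [x Vx] := V0 (rev (mkseq sigma n)); exists x; split => //;
      exact: subset_closure.
  split; first by apply: bigcup_open => B /FP[].
  move=> sigma.
  have [|B FB|B FB|B C FB FC|x Fx] := @directed_bigcap_nonempty K (set K) F
      (fun B => ~` B `&` branch sigma) cK.
  - by exists B0.
  - apply: closedI; first by apply: open_closedC; have [] := FP _ FB.
    by apply: closed_bigI => n _; exact: closed_closure.
  - by have [_] := FP _ FB; exact.
  - have [BC|CB] := totF _ _ FB FC; [exists C|exists B] => // x [nx xs]; split;
      split => // xB; apply: nx; [exact: BC|exact: CB].
  - exists x; split; last by have [] := Fx _ FB0.
    by move=> [B FB Bx]; have [] := Fx _ FB.
exists (~` B); split => //; first exact: open_closedC.
move=> U oU [x [nBx Ux]].
have : ~ P (B `|` U).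
  apply: maxB; split; first by move=> y; left.
  by move=> /(_ x (or_intror Ux)).
move=> /not_andP[nop|]; first by case: nop; exact: openU.
move=> /existsNP[sigma nsigma].
have [N LN] : exists N, ~` B `&` closure (V (rev (mkseq sigma N))) `<=` U.
  apply: contrapT => /forallNP nN; apply: nsigma.
  apply: closed_meets_branch; first by apply: open_closedC; exact: openU.
  move=> n; have /existsNP[y /not_implyP[[nBy yV] nUy]] := nN n.
  by exists y; split => // -[].
exists sigma, N; elim=> [|n IH]; first by rewrite leqn0 => /eqP <-.
rewrite leq_eqVlt => /orP[/eqP <-//|]; rewrite ltnS => /IH nU y [nBy yV].
apply: nU; split => //; move: yV; rewrite rev_mkseqS => /VS.
exact: subset_closure.
Qed.

(** A Baire category argument on [L]: words [S m] of growing length are chosen so that the trace on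
    [L] of [closure (V (S m.+1))] is nonempty and lies in [V (S m)] and [G m]. A point common to
    these nested compact traces is as required. *)
Lemma transversal_baire (L : set K) (G : nat -> set K) : closed L ->
  (forall sigma, L `&` branch sigma !=set0) ->
  (forall U, open U -> L `&` U !=set0 -> exists sigma N,
    forall n, (N <= n)%N -> L `&` closure (V (rev (mkseq sigma n))) `<=` U) ->
  (forall m, open (G m)) -> (forall s m, L `&` (V s `&` G m) !=set0) ->
  exists x, (forall m, G m x) /\ forall n, exists2 s, (n <= size s)%N & V s x.
Proof.
move=> cL Lb Lmin oG LG; have [oV V0 VS _] := VP.
have /choice[next nextP] : forall p : nat * seq bool, exists t : seq bool,
    [/\ (size p.2 < size t)%N, L `&` closure (V t) `<=` V p.2 `&` G p.1 &
      L `&` closure (V t) !=set0].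
  move=> [m s] /=; have [sigma [N LN]] := Lmin _ (openI (oV s) (oG m)) (LG s m).
  exists (rev (mkseq sigma (maxn N (size s).+1))).
  rewrite size_rev size_mkseq leq_maxr; split => //; first by apply: LN; exact: leq_maxl.
  by have [x [Lx xb]] := Lb sigma; exists x; split => //; exact: xb.
pose S := fix S m := if m is k.+1 then next (k, S k) else [::].
have nSP m := nextP (m, S m).
have dS m n : (m <= n)%N -> L `&` closure (V (S n)) `<=` L `&` closure (V (S m)).
  elim: n => [|n IH]; first by rewrite leqn0 => /eqP ->.
  rewrite leq_eqVlt => /orP[/eqP ->//|]; rewrite ltnS => /IH; apply: subset_trans.
  have [_ SV _] := nSP n.
  by move=> x xS; split; [case: xS|apply: subset_closure; have [] := SV _ xS].
have [|n _|n _|m n _ _|x Lx] := @directed_bigcap_nonempty K nat setT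
    (fun n => L `&` closure (V (S n))) cK.
- by exists 0%N.
- by apply: closedI => //; exact: closed_closure.
- case: n => [|n]; last by have [] := nSP n.
  by have [x [xL [xV _]]] := LG [::] 0%N; exists x; split => //; exact: subset_closure.
- exists (maxn m n) => // x xS; split; apply: dS xS; rewrite ?leq_maxl ?leq_maxr//.
have VGx m : (V (S m) `&` G m) x by have [_ SV _] := nSP m; apply: SV (Lx m.+1 I).
exists x; split => [m|n]; first by have [] := VGx m.
exists (S n); last by have [] := VGx n.
elim: n => // n IH; have [+ _ _] := nSP n; exact: leq_ltn_trans.
Qed.

End CantorScheme.

(** * Functions on C_p that detect large values on finite sets *)

Lemma continuous_truncate (R : realType) (T : topologicalType) (f : T -> R) (c : R) :
  continuous f -> continuous (fun t => Num.min 1 (Num.max 0 (f t - c))).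
Proof.
move=> cf; apply: (@min_fun_continuous _ _ R (fun=> 1)); first exact: cst_continuous.
apply: (@max_fun_continuous _ _ R (fun=> 0)); first exact: cst_continuous.
by move=> t; apply: cvgB; [exact: cf|exact: cvg_cst].
Qed.

Section DetectingSequence.
Variables (R : realType) (X : topologicalType) (F : nat -> seq X).
Hypotheses (crX : completely_regular_space X) (aX : accessible_space X).

(** This vanishes unless [g > n] on all of [F n], and equals 1 once [g >= n + 1] there. *)
Definition detector (n : nat) (g : Cp R X) : R :=
  \prod_(x <- F n) Num.min 1 (Num.max 0 (ev g x - n%:R)).

Lemma detector_continuous n : continuous (detector n).
Proof.
apply: (@continuous_big R X *%R 1 xpredT (@mul_continuous R) (Cp R X) (F n)
  (fun x g => Num.min 1 (Num.max 0 (ev g x - n%:R)))) => x _.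
exact: continuous_truncate (@ev_continuous_r R X x).
Qed.

Lemma detector_not_ascoli : trivIset [set: nat] (fun n => [set` F n]) ->
  (forall S : set (Cp R X), compact S ->
    \forall n \near \oo, forall g, S g -> exists2 x, x \in F n & ev g x <= n%:R) ->
  ~ ascoli_space R (Cp R X).
Proof.
move=> tF SF [_ asc].
pose phi n : Ck R (Cp R X) := mkcts (@detector_continuous n).
pose zero : Ck R (Cp R X) := mkcts (@cst_continuous (Cp R X) R 0).
pose z : Cp R X := mkCp (@cst_continuous X R 0).
have phi0 : phi @ \oo --> zero.
  apply: Ck_cvg => S W cS oW SW; have := SF _ cS; apply: filterS => n Sn g Sg.
  have [x xF gx] := Sn g Sg.
  suff -> : evk (phi n) g = 0 by exact: SW Sg.
  rewrite -[evk _ _]/(detector n g) /detector (big_rem x)//=.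
  by rewrite (max_idPl _) ?subr_le0// (min_idPr _) ?ler01// mul0r.
have cK := compact_cvg_seq (N := 0) phi0.
have K0 : zero \in [set zero] `|` phi @` [set n | (0 <= n)%N] by apply/mem_set; left.
have := asc _ cK (z, SigSub K0).
move=> /cvgrPdist_lt/(_ 1 ltr01)[[A B] /= [zA zB] AB].
have /Cp_nbhsP[s [d [d0 sA]]] := zA.
have [_ [[W oW <-] W0 WB]] := zB.
have phiW : \forall n \near \oo, W (phi n) := phi0 _ (open_nbhs_nbhs (conj oW W0)).
(* Each point of the finite set [s] lies in at most one of the disjoint sets [F n]. *)
have sF : \forall n \near \oo, forall x, x \in s -> x \notin F n.
  elim: s {sA} => [|x s IH]; first by apply: nearW.
  have [[k xk]|nx] := pselect (exists k, x \in F k).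
    have kn : \forall n \near \oo, (k < n)%N by exists k.+1.
    apply: filterS2 kn IH => n kn sF y; rewrite inE => /orP[/eqP ->|/sF//].
    apply/negP => xn; have kE := tF k n I I (ex_intro _ x (conj xk xn)).
    by rewrite kE ltnn in kn.
  apply: filterS IH => n sF y; rewrite inE => /orP[/eqP ->|/sF//].
  by apply/negP => xn; apply: nx; exists n.
have [n [Wn sn]] := filter_ex (filterI phiW sF).
have [|x xF|u [cu _ u1 u0]] := @uniform_separator_finite R X (F n) (~` [set` s]) crX.
- by rewrite openC; apply: (accessible_finite_set_closed.1 aX).
- by move=> xs; have := sn _ xs; rewrite xF.
(* [h] vanishes on [s], hence is in [A], while its value [n + 1] on [F n] makes every factor of the
   detector equal to 1. *)
pose h x := n.+1%:R * u x.
have ch : continuous h by move=> x; apply: cvgM; [exact: cvg_cst|exact: cu].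
have Kn : phi n \in [set zero] `|` phi @` [set n | (0 <= n)%N].
  by apply/mem_set; right; exists n.
have An : A (mkCp ch).
  apply: sA => x xs.
  suff -> : ev (mkCp ch) x - ev z x = 0 by rewrite normr0.
  by rewrite -[LHS]/(h x - 0) /h u0 ?mulr0 ?subr0// => /(_ xs).
have : `|0 - detector n (mkCp ch)| < 1.
  by apply: (AB (mkCp ch, SigSub Kn)); split; last exact: WB.
suff -> : detector n (mkCp ch) = 1 by rewrite sub0r normrN normr1 ltxx.
rewrite /detector big_seq big1// => x xF.
rewrite -[ev _ x]/(h x) /h u1// mulr1 -natrB// subSnn.
by rewrite (max_idPr _) ?ler01// minxx.
Qed.

End DetectingSequence.

(** * Finite sets read off from a Cantor scheme, and the conclusion of (i) *)

(** The sequence follows the word [s], then takes one [true], then the default value [false]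
    forever. *)
Lemma rev_mkseq_nth (s : seq bool) :
  rev (mkseq (nth false (rcons (rev s) true)) (size s)) = s.
Proof.
rewrite -[RHS]revK; congr rev; apply: (@eq_from_nth _ false).
  by rewrite size_mkseq size_rev.
rewrite size_mkseq => i si.
by rewrite nth_mkseq// nth_rcons size_rev si.
Qed.

(* [F n] picks one point of the transversal below every word of length [n],
   always on a branch whose last [true] is at position [n]. *)
Lemma cech_complete_crowded_baire (X : topologicalType) (A : set X) :
  cech_complete X -> A !=set0 -> ~ (isolated A !=set0) ->
  exists F : nat -> seq X, trivIset [set: nat] (fun n => [set` F n]) /\
    forall H : nat -> set X, (forall m, open (H m)) ->
      (forall m N, exists2 n, (N <= n)%N & forall x, x \in F n -> H m x) ->
      \bigcap_m H m !=set0.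
Proof.
move=> [_ [K [e [cK hK [einj ce eopen] _ [W oW eW]]]]] [a0 Aa0] nisoA.
have [|x U [a Aa <-] Ux|n|V VP VW] :=
  @crowded_cantor_scheme K cK hK (e @` A) W _ _ _.
- by exists (e a0), a0.
- have nU : nbhs a (e @^-1` U) by exact: ce.
  apply: contrapT => nex; apply: nisoA; exists a; split; first exact: mem_set.
  exists (e @^-1` U) => //; apply/seteqP; split => [b [Ub Ab]|_ ->]; last first.
    by split => //; exact: nbhs_singleton.
  apply: contrapT => ba; apply: nex; exists (e b); split => //.
  by apply/eqP => /einj.
- split => // _ [a _ <-]; have ea : range e (e a) by exists a.
  by rewrite eW in ea; exact: ea.
(* Points lying in [V s] for arbitrarily long [s] are in every [W i], that is, in the range of
   [e]. *)
have inW x s i : (i < size s)%N -> V s x -> W i x.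
  have [_ _ VS _] := VP.
  elim: s => // b s IH /=; rewrite ltnS leq_eqVlt => /orP[/eqP ->|/IH iW Vx].
    exact: VW.
  by apply/iW/VS/subset_closure/Vx.
have [L [cL Lb Lmin]] := irreducible_transversal cK VP.
pose sigma s := nth false (rcons (rev s) true).
have /choice[p pP] s : exists x, L (e x) /\ branch V (sigma s) (e x).
  have [y [Ly yb]] := Lb (sigma s).
  suff [x _ xy] : range e y by exists x; rewrite xy.
  rewrite eW => i _; apply: (inW y (rev (mkseq (sigma s) i.+1))).
    by rewrite size_rev size_mkseq.
  exact: branch_scheme.
exists (fun n => [seq p (tval t) | t : n.-tuple bool]); split.
  apply: ltn_trivIset => i j ij; apply/seteqP; split => // x [/=].
  move=> /mapP[t _ xt] /mapP[u _ xu].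
  have [_ bt] := pP t; have [_ bu] := pP u.
  rewrite -xt in bt; rewrite -xu in bu.
  (* Here [j < i]: at position [i] the sequence of the longer word is [true], that of the shorter
     one already [false]. *)
  have := branch_inj VP bt bu i; rewrite /sigma !nth_rcons !size_rev !size_tuple.
  by rewrite ltnn eqxx ltnNge (ltnW ij) (gtn_eqF ij).
move=> H oH HF.
have /choice[G GP] m : exists U : set K, open U /\ U `&` range e = e @` H m.
  have /open_subspaceP[U oU UE] := eopen _ (oH m).
  exists U; split => //; rewrite UE; apply/setIidPl => _ [x _ <-]; by exists x.
have [|s m|x [Gx xV]] := transversal_baire cK VP cL Lb Lmin (G := G).
- by move=> m; have [] := GP m.
- have [n sn Hn] := HF m (size s).
  (* Padding [s] to length [n] yields a word below [s], so the point of [F n] chosen for it lies in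
     [V s]. *)
  pose t := nseq (n - size s) false ++ s.
  have st : size t == n by rewrite size_cat size_nseq subnK.
  have [Lt bt] := pP t.
  exists (e (p t)); split => //; split.
    apply: (@scheme_cat _ _ VP s (nseq (n - size s) false)); rewrite -/t.
    by have := branch_scheme VP (size t) bt; rewrite rev_mkseq_nth.
  have [_ GE] := GP m.
  suff : (G m `&` range e) (e (p t)) by case.
  rewrite GE; exists (p t) => //; apply: Hn.
  by apply/mapP; exists (Tuple st); rewrite ?mem_enum.
have [y _ yx] : range e x.
  by rewrite eW => i _; have [s si Vs] := xV i.+1; exact: inW Vs.
exists y => m _; have [_ GE] := GP m.
have : (G m `&` range e) x by split; [exact: Gx|exists y].
by rewrite GE => -[y' Hy']; rewrite -yx => /einj <-.
Qed.

Lemma Cp_cech_complete_ascoli_scattered (R : realType) (X : topologicalType) :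
  tychonoff_space X -> cech_complete X -> ascoli_space R (Cp R X) ->
  scattered_space X.
Proof.
move=> [aX crX] cX asc A A0; apply: contrapT => isoA.
have [F [tF HF]] := cech_complete_crowded_baire cX A0 isoA.
apply: (detector_not_ascoli crX aX tF _ asc) => S cS.
apply: contrapT => nS.
(* If infinitely many [n] have some [g] in [S] with [g > n] on [F n], the Baire property gives a
   point [x] at which [S] is unbounded, whereas evaluation at [x] maps [S] onto a compact set. *)
have [x Sx] : \bigcap_m (\bigcup_(g in S) [set x | m%:R < ev g x]) !=set0.
  apply: HF => [m|m N].
    apply: bigcup_open => g _.
    apply: (@open_comp _ _ (ev g) [set r : R | m%:R < r]) => [y _|].
      exact: ev_continuous_l.
    exact: open_gt.
  apply: contrapT => nN; apply: nS; exists (maxn m N) => // n /=.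
  rewrite geq_max => /andP[mn Nn] g Sg; apply: contrapT => nx.
  apply: nN; exists n => // x xF; exists g => //=.
  rewrite ltNge; apply/negP => gm; apply: nx; exists x => //.
  by rewrite (le_trans gm)// ler_nat.
have : compact ((fun g : Cp R X => ev g x) @` S).
  apply: continuous_compact => //; apply: continuous_subspaceT.
  exact: ev_continuous_r.
move=> /compact_bounded[M [_ MS]].
have := archi_boundP (normr_ge0 (M + 1)).
set m := Num.bound _ => Mm.
have [g Sg] := Sx m I; rewrite /= ltNge => /negP; apply.
have M1 : M < M + 1 by rewrite ltrDl.
rewrite (le_trans (ler_norm _))// (le_trans (MS _ M1 _ (ex_intro2 _ _ g Sg erefl)))//.
by rewrite (le_trans (ler_norm _))// ltW.
Qed.

Theorem theorem1p3 (R : realType) (X : topologicalType)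
    (hX : tychonoff_space X) :
  (cech_complete X -> ascoli_space R (Cp R X) -> scattered_space X) /\
  (scattered_space X -> stratifiable_space X -> ascoli_space R (Cp R X)).
Proof.
split; first exact: Cp_cech_complete_ascoli_scattered.
exact: Cp_scattered_stratifiable_ascoli.
Qed.
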